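(* Let $(M,A,g,F,\eta,\xi)$ be an almost contact metric manifold with fundamental 2-form $F$, considered as a generalized Riemannian manifold $(M,G)$ with generalized Riemannian metric $G=g+F$. Then $(M,G)$ satisfies the Einstein metricity condition with a totally skew-symmetric torsion $T$ (that is, there is a linear connection $\nabla$ with totally skew-symmetric torsion $T$ satisfying this condition) if and only if $(M,A,g,F,\eta,\xi)$ is almost-nearly cosymplectic, i.e. $$g((\nabla^g_XA)Y,Z)=-\tfrac13dF(AX,AY,Z)+\tfrac16\eta(Z)d\eta(Y,AX)-\tfrac12\eta(Y)d\eta(AZ,X).$$ The skew-symmetric torsion is determined by $$T(X,Y,Z)=-\tfrac13dF(X,Y,Z)=-\tfrac14N(AX,AY,AZ)+\tfrac13\big[\eta(X)d\eta(Y,AZ)+\eta(Y)d\eta(Z,AX)+\eta(Z)d\eta(X,AY)\big].$$ The connection is unique and given by $$g(\nabla_XY,Z)=g(\nabla^g_XY,Z)-\tfrac16dF(X,Y,Z)+\tfrac16\big[\eta(X)d\eta(Y,Z)+\eta(Y)d\eta(X,Z)\big].$$ The Einstein metricity condition has the form $(\nabla_XG)(Y,Z)=\frac13\big[dF(X,Y,Z)-dF(X,Y,AZ)\big]$. The covariant derivatives of $g$ and $F$ are $$(\nabla_Xg)(Y,Z)=\tfrac16\big[\eta(Y)d\eta(Z,X)+\eta(Z)d\eta(Y,X)\big],$$ $$(\nabla_XF)(Y,Z)=\tfrac13\big[dF(X,Y,Z)-dF(X,Y,AZ)\big]-\tfrac16\big[\eta(Y)d\eta(Z,X)+\eta(Z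)d\eta(Y,X)\big].$$
   Context: An almost contact metric manifold $(M^{2n+1},g,A,\eta,\xi)$ is a $(2n+1)$-dimensional Riemannian manifold with a 1-form $\eta$, a $(1,1)$-tensor $A$ and a vector field $\xi$ dual to $\eta$, such that $\eta(\xi)=1$, $\eta(X)=g(X,\xi)$, $A^2=-\mathrm{id}+\eta\otimes\xi$, $g(AX,AY)=g(X,Y)-\eta(X)\eta(Y)$, $A\xi=0$; its fundamental 2-form is $F(X,Y)=g(AX,Y)$. A generalized Riemannian manifold $(M,G)$ is a manifold with a (in general non-symmetric) $(0,2)$-tensor $G=g+F$, with $g$ its symmetric part, assumed non-degenerate, and $F$ its skew-symmetric part. Let $\nabla^g$ be the Levi-Civita connection of $g$. The almost contact metric manifold is called almost-nearly cosymplectic if the displayed formula for $g((\nabla^g_XA)Y,Z)$ in the claim holds for all $X,Y,Z$. The torsion of $\nabla$ is $T(X,Y)=\nabla_XY-\nabla_YX-[X,Y]$, with $T(X,Y,Z)=g(T(X,Y),Z)$; it is totally skew-symmetric if $T(X,Y,Z)=-T(X,Z,Y)$. A linear connection $\nabla$ satisfies the Einstein metricity condition if $XG(Y,Z)-G(\nabla_YX,Z)-G(Y,\nabla_XZ)=0$ for commuting vector fields $X,Y,Z$, equivalently $(\nabla_XG)(Y,Z)=-G(T(X,Y),Z)$. The Nijenhuis tensor of $A$ is $N(X,Y)=[AX,AY]+A^2[X,Y]-A[AX,Y]-A[X,AY]$, with $N(X,Y,Z)=g(N(X,Y),Z)$. Exterior derivatives are normalized so that for commuting vector fields $dF(X,Y,Z)=XF(Y,Z)+YF(Z,X)+ZF(X,Y)$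 and $d\eta(X,Y)=X\eta(Y)-Y\eta(X)$. Tensor identities hold for all vector fields.
   Formalization: The sign of the bracket of η·dη terms is reversed in the formulas for g(∇_X Y,Z), (∇_X g)(Y,Z) and (∇_X F)(Y,Z): the printed signs contradict the formula for T unless dη=0, which fails for a rescaled Sasaki–Einstein structure on S^5. *)

(* Defs.v *)
From HB Require Import structures.
From mathcomp Require Import all_boot all_order all_algebra.
From mathcomp Require Import all_classical all_reals all_analysis.
Import Order.TTheory GRing.Theory Num.Theory.
Import numFieldNormedType.Exports.

Set Implicit Arguments.
Unset Strict Implicit.
Unset Printing Implicit Defensive.

Local Open Scope classical_set_scope.
Local Open Scope ring_scope.

(* f is C^k on U; meaningful for open U only, where the partial        *)
(* derivatives do not depend on the values of f off U.                 *)
Fixpoint Cn_on (R : realType) (m k : nat) (U : set 'rV[R]_m)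
    (f : 'rV[R]_m -> R) : Prop :=
  (forall x, U x -> {for x, continuous f}) /\
  if k is k'.+1 then
    forall i : 'I_m,
      (forall x, U x -> derivable f x (delta_mx 0 i)) /\
      Cn_on k' U (fun x => 'D_(delta_mx 0 i) f x)
  else True.

Definition smooth_on (R : realType) (m : nat) (U : set 'rV[R]_m)
    (f : 'rV[R]_m -> R) : Prop :=
  forall k, Cn_on k U f.

Section Cn_on_theory.
Context (R : realType) (m : nat) (U : set 'rV[R]_m) (Uo : open U).
Implicit Types f g : 'rV[R]_m -> R.

Lemma Cn_on_cont k f : Cn_on k U f -> forall x, U x -> {for x, continuous f}.
Proof. by case: k => [|k] []. Qed.

Let nbhsU x : U x -> nbhs x U.
Proof. by move=> Ux; rewrite nbhsE; exists U. Qed.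

Let cont_ext f g : (forall x, U x -> f x = g x) ->
  (forall x, U x -> {for x, continuous f}) ->
  forall x, U x -> {for x, continuous g}.
Proof.
move=> fg cf x Ux; have fgx : {near x, f =1 g} by exact: (filterS fg (nbhsU Ux)).
have fx : f @ x --> f x := cf x Ux.
rewrite fg// in fx.
by apply: cvg_trans fx; exact: (near_eq_cvg fgx).
Qed.

Lemma Cn_on_ext k f g : (forall x, U x -> f x = g x) ->
  Cn_on k U f -> Cn_on k U g.
Proof.
elim: k f g => [|k IH] f g fg [cf df]; split;
  [exact: cont_ext cf|by []|exact: cont_ext cf|].
move=> i; have [dfi Cfi] := df i; split=> [x Ux|].
  by apply: near_eq_derivable (dfi x Ux); exact: (filterS fg (nbhsU Ux)).
apply: IH Cfi => x Ux; apply: near_eq_derive.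
exact: (filterS fg (nbhsU Ux)).
Qed.

Lemma Cn_onW k f : Cn_on k.+1 U f -> Cn_on k U f.
Proof.
elim: k f => [|k IH] f [cf df]; split=> // i.
by have [dfi Cfi] := df i; split=> //; exact: IH.
Qed.

Lemma Cn_on_cst k (a : R) : Cn_on k U (cst a).
Proof.
elim: k a => [|k IH] a; split;
  [move=> x _; exact: cst_continuous|by []|move=> x _; exact: cst_continuous|].
move=> i; split=> [x _|]; first exact: derivable_cst.
by apply: Cn_on_ext (IH 0) => x _; rewrite /cst derive_cst.
Qed.

Lemma Cn_onD k f g : Cn_on k U f -> Cn_on k U g -> Cn_on k U (f + g).
Proof.
elim: k f g => [|k IH] f g [cf df] [cg dg].
  by split=> // x Ux; apply: continuousD; [exact: cf|exact: cg].
split=> [x Ux|i]; first by apply: continuousD; [exact: cf|exact: cg].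
have [dfi Cfi] := df i; have [dgi Cgi] := dg i; split=> [x Ux|].
  by apply: derivableD; [exact: dfi|exact: dgi].
apply: Cn_on_ext (IH _ _ Cfi Cgi) => x Ux.
by rewrite deriveD//; [exact: dfi|exact: dgi].
Qed.

Lemma Cn_onM k f g : Cn_on k U f -> Cn_on k U g -> Cn_on k U (f * g).
Proof.
elim: k f g => [|k IH] f g Cf Cg.
  case: Cf Cg => [cf _] [cg _].
  by split=> // x Ux; apply: continuousM; [exact: cf|exact: cg].
have [cf df] := Cf; have [cg dg] := Cg.
split=> [x Ux|i]; first by apply: continuousM; [exact: cf|exact: cg].
have [dfi Cfi] := df i; have [dgi Cgi] := dg i; split=> [x Ux|].
  by apply: derivableM; [exact: dfi|exact: dgi].
apply: Cn_on_ext (Cn_onD (IH _ _ (Cn_onW Cf) Cgi) (IH _ _ (Cn_onW Cg) Cfi)).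
by move=> x Ux; rewrite deriveM//; [exact: dfi|exact: dgi].
Qed.

End Cn_on_theory.

(* A chart is a homeomorphism from an open subset of M onto an open    *)
(* subset of R^m; chart_fun and chart_inv are total functions whose    *)
(* values off chart_dom and chart_cod are irrelevant.                  *)
Record chart (R : realType) (m : nat) (M : topologicalType) := Chart {
  chart_dom : set M ;
  chart_fun : M -> 'rV[R]_m ;
  chart_inv : 'rV[R]_m -> M ;
  chart_dom_open : open chart_dom ;
  chart_cod_open : open (chart_fun @` chart_dom) ;
  chart_funK : forall p, chart_dom p -> chart_inv (chart_fun p) = p ;
  chart_fun_continuous :
    forall p, chart_dom p -> {for p, continuous chart_fun} ;
  chart_inv_continuous :
    forall x, (chart_fun @` chart_dom) x -> {for x, continuous chart_inv}
}.

Arguments chart_dom_open {R m M} c : rename.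
Arguments chart_cod_open {R m M} c : rename.

Definition chart_cod (R : realType) (m : nat) (M : topologicalType)
  (c : chart R m M) : set 'rV[R]_m := chart_fun c @` chart_dom c.

Record smoothManifold (R : realType) (m : nat) := SmoothManifold {
  manifold_sort :> topologicalType ;
  atlas : set (chart R m manifold_sort) ;
  atlas_cover : forall p, exists2 c, atlas c & chart_dom c p ;
  atlas_compatible : forall c c', atlas c -> atlas c' -> forall i : 'I_m,
    smooth_on (chart_fun c @` (chart_dom c `&` chart_dom c'))
      (fun x => chart_fun c' (chart_inv c x) 0 i) ;
  manifold_hausdorff : hausdorff_space manifold_sort ;
  manifold_second_countable : @second_countable manifold_sort
}.

Definition smooth_fun (R : realType) (m : nat) (M : smoothManifold R m)
    (f : M -> R) : Prop :=
  forall c, atlas c -> smooth_on (chart_cod c) (f \o chart_inv c).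

Definition smooth_pred (R : realType) (m : nat) (M : smoothManifold R m) :
  {pred M -> R} := [pred f | `[< smooth_fun f >]].
Arguments smooth_pred {R m} M _ : assert.

Record smoothFun (R : realType) (m : nat) (M : smoothManifold R m) :=
  SmoothFun { smooth_val :> M -> R ; _ : smooth_val \in smooth_pred M }.

Section smoothFun_algebra.
Context (R : realType) (m : nat) (M : smoothManifold R m).

HB.instance Definition _ := [isSub for @smooth_val R m M].
HB.instance Definition _ := [Choice of smoothFun M by <:].

Let smooth_subring : subring_closed (smooth_pred M).
Proof.
split; first by apply/asboolP => c ac k; exact: (Cn_on_cst (chart_cod_open c) k 1).
- move=> f g /asboolP sf /asboolP sg; apply/asboolP => c ac k.
  have oc := chart_cod_open c.
  have sN := Cn_onM oc (Cn_on_cst oc k (-1)) (sg c ac k).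
  apply: Cn_on_ext (Cn_onD oc (sf c ac k) sN) => // x _.
  by rewrite /GRing.add/= /GRing.mul/= mulN1r.
- move=> f g /asboolP sf /asboolP sg; apply/asboolP => c ac k.
  exact: (Cn_onM (chart_cod_open c) (sf c ac k) (sg c ac k)).
Qed.

HB.instance Definition _ :=
  GRing.SubChoice_isSubComPzRing.Build (M -> R) (smooth_pred M) (smoothFun M)
    smooth_subring.

Let smooth_submod : subsemimod_closed (smooth_pred M).
Proof.
have [_ _ sM] := smooth_subring.
split; first exact: GRing.zmod_closedD (GRing.subring_closedB smooth_subring).
move=> a f sf; apply: (sM (cst a)) sf.
by apply/asboolP => c ac k; exact: (Cn_on_cst (chart_cod_open c) k a).
Qed.

HB.instance Definition _ :=
  GRing.SubZmodule_isSubLmodule.Build R (M -> R) (smooth_pred M) (smoothFun M)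
    smooth_submod.

End smoothFun_algebra.

(* Vector fields are the R-linear derivations of C^oo(M) = smoothFun M *)
(* and form a module over it; tensor fields are C^oo(M)-multilinear    *)
(* maps on vector fields.                                              *)
Definition derivation (R : realType) (m : nat) (M : smoothManifold R m)
    (D : smoothFun M -> smoothFun M) : Prop :=
  (forall (a : R) f g, D (a *: f + g) = a *: D f + D g) /\
  (forall f g, D (f * g) = D f * g + f * D g).

(* C^oo(M)^o is C^oo(M) seen as a module over itself. *)
Definition derivation_pred (R : realType) (m : nat) (M : smoothManifold R m) :
  {pred smoothFun M -> (smoothFun M)^o} := [pred D | `[< derivation D >]].
Arguments derivation_pred {R m} M _ : assert.

Record vectorField (R : realType) (m : nat) (M : smoothManifold R m) :=
  VectorField {
    vf_val :> smoothFun M -> (smoothFun M)^o ;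
    _ : vf_val \in derivation_pred M
  }.

Section vectorField_module.
Context (R : realType) (m : nat) (M : smoothManifold R m).

HB.instance Definition _ := [isSub for @vf_val R m M].
HB.instance Definition _ := [Choice of vectorField M by <:].

Lemma vf_derivation (X : vectorField M) : derivation X.
Proof. by case: X => D pD; apply/asboolP. Qed.

Lemma smooth_scaleAl (a : R) (f g : smoothFun M) : (a *: f) * g = a *: (f * g).
Proof.
by apply/val_inj/funext => p; exact: (esym (mulrA a (f p) (g p))).
Qed.

Lemma smooth_scaleAr (a : R) (f g : smoothFun M) : f * (a *: g) = a *: (f * g).
Proof. by rewrite mulrC smooth_scaleAl mulrC. Qed.

Let derivation_submod : subsemimod_closed (derivation_pred M).
Proof.
split; first split.
- apply/asboolP; split=> [a f g|f g] /=.
    by rewrite scaler0 addr0.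
  by rewrite mul0r mulr0 addr0.
- move=> D E /asboolP[Dl DL] /asboolP[El EL]; apply/asboolP.
  pose DE f : smoothFun M := D f + E f.
  suff: derivation DE by [].
  split=> [a f g|f g]; rewrite /DE.
    by rewrite Dl El scalerDr addrACA.
  by rewrite DL EL mulrDl mulrDr addrACA.
- move=> h D /asboolP[Dl DL]; apply/asboolP.
  pose hD f : smoothFun M := h * D f.
  suff: derivation hD by [].
  split=> [a f g|f g]; rewrite /hD.
    by rewrite Dl mulrDr smooth_scaleAr.
  by rewrite DL mulrDr mulrA mulrCA.
Qed.

HB.instance Definition _ :=
  GRing.SubChoice_isSubLmodule.Build (smoothFun M)
    (smoothFun M -> (smoothFun M)^o) (derivation_pred M) (vectorField M)
    derivation_submod.

Let bracket_derivation (X Y : vectorField M) :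
  (fun f => X (Y f) - Y (X f) : (smoothFun M)^o) \in derivation_pred M.
Proof.
have [Xl XL] := vf_derivation X; have [Yl YL] := vf_derivation Y.
have XD f g : X (f + g) = X f + X g by rewrite -[f]scale1r Xl !scale1r.
have YD f g : Y (f + g) = Y f + Y g by rewrite -[f]scale1r Yl !scale1r.
apply/asboolP; split=> [a f g|f g].
  by rewrite !(Xl, Yl) scalerBr opprD addrACA.
rewrite !(XL, YL, XD, YD) mulrBl mulrBr !opprD !addrA.
move: (X (Y f) * g) (Y f * X g) (X f * Y g) => a b c.
move: (f * X (Y g)) (Y (X f) * g) (f * Y (X g)) => d e h.
rewrite [_ - e - c]addrAC [_ + d - c]addrAC addrK.
by rewrite [_ - e - b]addrAC [_ + d - b]addrAC addrK [a + d - e]addrAC.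
Qed.

Definition lie_bracket (X Y : vectorField M) : vectorField M :=
  VectorField (bracket_derivation X Y).

End vectorField_module.

Notation tensor02 M := (vectorField M -> vectorField M -> smoothFun M).

Record connection (R : realType) (m : nat) (M : smoothManifold R m) :=
  Connection {
    nabla :> vectorField M -> vectorField M -> vectorField M ;
    nabla_linearl : forall (f : smoothFun M) X X' Y,
      nabla (f *: X + X') Y = f *: nabla X Y + nabla X' Y ;
    nabla_additiver : forall X Y Y', nabla X (Y + Y') = nabla X Y + nabla X Y' ;
    nabla_leibniz : forall (f : smoothFun M) X Y,
      nabla X (f *: Y) = (X f : smoothFun M) *: Y + f *: nabla X Y
  }.

Section tensor_calculus.
Context (R : realType) (m : nat) (M : smoothManifold R m).
Implicit Types (D : connection M) (X Y Z : vectorField M) (B : tensor02 M).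

Definition torsion D X Y : vectorField M :=
  D X Y - D Y X - lie_bracket X Y.

Definition torsion3 (g : tensor02 M) D X Y Z : smoothFun M :=
  g (torsion D X Y) Z.

Definition totally_skew_torsion (g : tensor02 M) D : Prop :=
  forall X Y Z, torsion3 g D X Y Z = - torsion3 g D X Z Y.

(* (nabla_X B)(Y, Z) *)
Definition cov02 D B X Y Z : smoothFun M :=
  X (B Y Z) - B (D X Y) Z - B Y (D X Z).

(* (nabla_X A) Y *)
Definition cov11 D (A : vectorField M -> vectorField M) X Y : vectorField M :=
  D X (A Y) - A (D X Y).

(* The exterior derivatives, normalized without numerical factors; the *)
(* bracket terms vanish on commuting vector fields.                    *)
Definition ext_d1 (w : vectorField M -> smoothFun M) X Y : smoothFun M :=
  X (w Y) - Y (w X) - w (lie_bracket X Y).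

Definition ext_d2 B X Y Z : smoothFun M :=
  X (B Y Z) + Y (B Z X) + Z (B X Y)
  - B (lie_bracket X Y) Z - B (lie_bracket Y Z) X - B (lie_bracket Z X) Y.

Definition nijenhuis (A : vectorField M -> vectorField M) X Y : vectorField M :=
  lie_bracket (A X) (A Y) + A (A (lie_bracket X Y))
  - A (lie_bracket (A X) Y) - A (lie_bracket X (A Y)).

(* When [X, Y] = 0 this equation reads                                 *)
(*   X G(Y,Z) - G(nabla_Y X, Z) - G(Y, nabla_X Z) = 0 ;                *)
(* in this tensorial form it is required of all vector fields.         *)
Definition einstein_metricity (G : tensor02 M) D : Prop :=
  forall X Y Z, cov02 D G X Y Z = - G (torsion D X Y) Z.

Definition levi_civita (g : tensor02 M) D : Prop :=
  (forall X Y Z, cov02 D g X Y Z = 0) /\ (forall X Y, torsion D X Y = 0).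

End tensor_calculus.

(* X vanishes at p iff (X f)(p) = 0 for every f, so the last two       *)
(* fields give positive definiteness on every tangent space.           *)
Record riemannianMetric (R : realType) (m : nat) (M : smoothManifold R m) :=
  RiemannianMetric {
    metric :> tensor02 M ;
    metric_sym : forall X Y, metric X Y = metric Y X ;
    metric_linear : forall (f : smoothFun M) X X' Y,
      metric (f *: X + X') Y = f * metric X Y + metric X' Y ;
    metric_ge0 : forall X (p : M), 0 <= metric X X p ;
    metric_eq0 : forall X (p : M), metric X X p = 0 ->
      forall f : smoothFun M, (X f : smoothFun M) p = 0
  }.

Record almostContactMetric (R : realType) (m : nat) (M : smoothManifold R m) :=
  AlmostContactMetric {
    acm_g : riemannianMetric M ;
    acm_A : {linear vectorField M -> vectorField M} ;
    acm_eta : {linear vectorField M -> (smoothFun M)^o} ;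
    acm_xi : vectorField M ;
    acm_eta_xi : acm_eta acm_xi = 1 ;
    acm_eta_dual : forall X : vectorField M, acm_eta X = acm_g X acm_xi ;
    acm_A2 : forall X : vectorField M, acm_A (acm_A X) = - X + acm_eta X *: acm_xi ;
    acm_compat : forall X Y : vectorField M,
      acm_g (acm_A X) (acm_A Y) = acm_g X Y - acm_eta X * acm_eta Y ;
    acm_A_xi : acm_A acm_xi = 0
  }.

Section almost_contact_metric.
Context (R : realType) (m : nat) (M : smoothManifold R m).
Variable S : almostContactMetric M.

Definition contact_form (X : vectorField M) : smoothFun M := acm_eta S X.

Definition fundamental_form : tensor02 M := fun X Y => acm_g S (acm_A S X) Y.

Definition generalized_metric : tensor02 M :=
  fun X Y => acm_g S X Y + fundamental_form X Y.

Definition almost_nearly_cosymplectic (Dg : connection M) : Prop :=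
  let A := acm_A S in
  let dF := ext_d2 fundamental_form in
  let deta := ext_d1 contact_form in
  forall X Y Z,
    acm_g S (cov11 Dg A X Y) Z =
      - (3^-1 *: dF (A X) (A Y) Z)
      + 6^-1 *: (contact_form Z * deta Y (A X))
      - 2^-1 *: (contact_form Y * deta (A Z) X).

End almost_contact_metric.

(* Main.v *)
Require Import Defs.
From HB Require Import structures.
From mathcomp Require Import all_boot all_order all_algebra lra.
From mathcomp Require Import all_classical all_reals all_analysis.
Import Order.TTheory GRing.Theory Num.Theory.

Set Implicit Arguments.
Unset Strict Implicit.
Unset Printing Implicit Defensive.

Local Open Scope ring_scope.

(** Write [nabla] for the Levi-Civita connection, and set
    Psi(X,Y,Z) = g((nabla_X A)Y, Z), h(X,Y) = g(nabla_X xi, Y), T = - dF / 3.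

    Let D have totally skew torsion T' and satisfy G-metricity.  The symmetric
    and skew parts of (D_X G)(Y,Z) = - T'(X,Y,Z) + T'(X,Y,AZ) in (Y,Z) express
    D g and D F through T'.  In the cyclic sum that computes dF from D F and
    T', all terms containing A cancel, which leaves dF = - 3 T', so T' = T.
    As D g and the torsion are now known, Koszul's formula gives D, whence
    uniqueness, and comparing D F with nabla F yields the equation
    [einstein_eq]:
      Psi(X,Y,Z) = - T(X,Y,Z) - T(X,AY,AZ) + (T(AX,Y,AZ) + T(AX,AY,Z)) / 2.

    The almost-nearly cosymplectic condition is another expression of Psi
    through T and d eta, called [cosymplectic_eq] below.  Differentiating
    A^2 = - id + eta (x) xi gives
      Psi(X,AY,Z) - Psi(X,Y,AZ) = eta(Z) h(X,Y) + eta(Y) h(X,Z),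
    and together with this identity either of the two equations forces xi to
    be a Killing field, h to be of type h(AX,Y) = h(X,AY), and A to pass from
    one argument of T to another up to terms in eta and h.  These
    consequences form the record [adapted] ([einstein_eq_adapted],
    [cosymplectic_eq_adapted]); modulo them the two equations are the same
    ([adapted_equations_agree]).  The relations in [adapted] also turn the
    Koszul expression of D, the formulas for D g and D F and the Nijenhuis
    tensor into the stated form, because d eta = 2 h.

    For the converse, Koszul's formula prescribes only the products of D_X Y
    with vector fields, so it has to be shown that they come from a vector
    field.  Under [cosymplectic_eq] the form T(X,Y,.) is the metric dual of an
    explicit combination of (nabla_{AX} A)(AY), xi, nabla_{AX} xi and
    nabla_{AY} xi ([torsion_field_exists]); adding to nabla the resulting
    Koszul term gives the connection ([skew_einstein_exists]). *)

(** * Smooth functions and pointwise arithmetic *)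

Section Pointwise.
Context (R : realType) (m : nat) (M : smoothManifold R m).
Implicit Types (f g : smoothFun M) (p : M).

Lemma smooth_ext f g : (forall p, f p = g p) -> f = g.
Proof. by move=> fg; apply/val_inj/funext. Qed.

Lemma smooth_at p f g : f = g -> f p = g p.
Proof. by move->. Qed.

Lemma smooth0E p : (0 : smoothFun M) p = 0. Proof. by []. Qed.
Lemma smooth1E p : (1 : smoothFun M) p = 1. Proof. by []. Qed.
Lemma smoothDE f g p : (f + g) p = f p + g p. Proof. by []. Qed.
Lemma smoothNE f p : (- f) p = - f p. Proof. by []. Qed.
Lemma smoothME f g p : (f * g) p = f p * g p. Proof. by []. Qed.
Lemma smoothZE (a : R) f p : (a *: f) p = a * f p. Proof. by []. Qed.
End Pointwise.

(** Smooth functions form neither a field nor an ordered ring, but a linear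
    identity with rational coefficients between them can be checked at each
    point, where it is an identity of real numbers.  The values at the point
    are generalized so that [lra] does not unfold the tensors producing them. *)
Ltac pointwise_lra :=
  let p := fresh "p" in
  intros;
  apply: smooth_ext => p;
  repeat match goal with
  | H : _ = _ |- _ => apply (smooth_at p) in H; revert H
  end;
  repeat match goal with
  | |- context [smooth_val (@GRing.add _ ?f ?g) p] => rewrite (smoothDE f g p)
  | |- context [smooth_val (@GRing.opp _ ?f) p] => rewrite (smoothNE f p)
  | |- context [smooth_val (@GRing.mul _ ?f ?g) p] => rewrite (smoothME f g p)
  | |- context [smooth_val (@GRing.scale _ _ ?a ?f) p] => rewrite (smoothZE a f p)
  | |- context [smooth_val (@GRing.zero _) p] => rewrite (smooth0E p)
  | |- context [smooth_val (@GRing.one _) p] => rewrite (smooth1E p)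
  end;
  repeat match goal with
  | |- context [smooth_val ?f p] => generalize (smooth_val f p)
  end;
  intros; lra.

(** * Linear forms, three-forms and connections *)

Section VectorFields.
Context (R : realType) (m : nat) (M : smoothManifold R m).
Local Notation K := (smoothFun M).
Local Notation V := (vectorField M).
Implicit Types X Y Z : V.

Definition linear_form (L : V -> K) : Prop :=
  forall (f : K) X Y, L (f *: X + Y) = f * L X + L Y.

Lemma linear_form0 L : linear_form L -> L 0 = 0.
Proof.
by move=> lL; have := lL (-1) 0 0; rewrite scaler0 addr0 mulN1r addNr.
Qed.

Lemma linear_formZ L (f : K) X : linear_form L -> L (f *: X) = f * L X.
Proof. by move=> lL; rewrite -[f *: X]addr0 lL linear_form0// addr0. Qed.

Lemma linear_formN L X : linear_form L -> L (- X) = - L X.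
Proof. by move=> lL; rewrite -scaleN1r linear_formZ// mulN1r. Qed.

Lemma linear_formD L X Y : linear_form L -> L (X + Y) = L X + L Y.
Proof. by move=> lL; rewrite -[X]scale1r lL mul1r scale1r. Qed.

Record three_form (T : V -> V -> V -> K) : Prop := ThreeForm {
  form_linear : forall Y Z, linear_form (fun X => T X Y Z) ;
  form_swap12 : forall X Y Z, T X Y Z = - T Y X Z ;
  form_swap23 : forall X Y Z, T X Y Z = - T X Z Y
}.

Section ThreeForm.
Context (T : V -> V -> V -> K) (formT : three_form T).

Lemma form_rot X Y Z : T X Y Z = T Y Z X.
Proof. by rewrite (form_swap12 formT) (form_swap23 formT) opprK. Qed.

Lemma form_linear2 X Z : linear_form (fun Y => T X Y Z).
Proof.
by move=> f Y Y'; rewrite !(form_rot X) (form_linear formT).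
Qed.

Lemma form_linear3 X Y : linear_form (T X Y).
Proof.
by move=> f Z Z'; rewrite -!(form_rot _ X) (form_linear formT).
Qed.

End ThreeForm.

Lemma vfD (X : V) (a b : K) : X (a + b) = X a + X b :> K.
Proof. by have [lX _] := vf_derivation X; rewrite -[a]scale1r lX !scale1r. Qed.

Lemma vf0 (X : V) : X 0 = 0 :> K.
Proof. by have := vfD X 0 0; rewrite addr0; pointwise_lra. Qed.

Lemma vfN (X : V) (a : K) : X (- a) = - (X a : K) :> K.
Proof. by have := vfD X a (- a); rewrite subrr vf0; pointwise_lra. Qed.

Lemma vf1 (X : V) : X 1 = 0 :> K.
Proof.
have [_ XM] := vf_derivation X; have := XM 1 1.
rewrite !mulr1 mul1r; pointwise_lra.
Qed.

Lemma lie_bracketC X Y : lie_bracket X Y = - lie_bracket Y X :> V.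
Proof.
apply/val_inj/funext => f; exact: (esym (opprB (Y (X f) : K) (X (Y f)))).
Qed.

Section Connection.
Context (D : connection M).

Lemma nabla0r X : D X 0 = 0.
Proof.
by have := nabla_additiver D X 0 0; rewrite addr0 -{1}[D X 0]addr0 => /addrI.
Qed.

Lemma nablaNr X Y : D X (- Y) = - D X Y.
Proof.
by apply/eqP; rewrite -addr_eq0 -nabla_additiver addNr nabla0r.
Qed.

Lemma torsionC X Y : torsion D X Y = - torsion D Y X.
Proof.
by rewrite /torsion (lie_bracketC X Y) opprD !opprK opprB.
Qed.

(** Connections form an affine space directed by the (1,2)-tensors. *)
Lemma connection_deform (B : V -> V -> V) :
  (forall (f : K) X X' Y, B (f *: X + X') Y = f *: B X Y + B X' Y) ->
  (forall (f : K) X Y Y', B X (f *: Y + Y') = f *: B X Y + B X Y') ->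
  exists D' : connection M, forall X Y, D' X Y = D X Y + B X Y.
Proof.
move=> Bl Br; pose N X Y : V := D X Y + B X Y.
have Nl (f : K) X X' Y : N (f *: X + X') Y = f *: N X Y + N X' Y.
  by rewrite /N nabla_linearl Bl scalerDr addrACA.
have Na X Y Y' : N X (Y + Y') = N X Y + N X Y'.
  by rewrite /N nabla_additiver -{2}[Y]scale1r Br scale1r addrACA.
have B0 X : B X 0 = 0.
  by have := Br (-1) X 0 0; rewrite scaler0 addr0 scaleN1r addNr.
have NL (f : K) X Y : N X (f *: Y) = (X f : K) *: Y + f *: N X Y.
  rewrite /N nabla_leibniz -[f *: Y]addr0 Br B0 addr0.
  by rewrite scalerDr addrA.
by exists (Connection Nl Na NL).
Qed.

End Connection.
End VectorFields.

(** * Almost contact metric structures *)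

Section AlmostContact.
Context (R : realType) (m : nat) (M : smoothManifold R m).
Context (S : almostContactMetric M).
Local Notation K := (smoothFun M).
Local Notation V := (vectorField M).
Local Notation g := (acm_g S).
Local Notation A := (acm_A S).
Local Notation xi := (acm_xi S).
Local Notation eta := (contact_form S).
Local Notation F := (fundamental_form S).
Local Notation G := (generalized_metric S).
Implicit Types X Y Z : V.

Lemma contact_form_linear : linear_form eta.
Proof. by move=> f X Y; rewrite /contact_form linearP. Qed.

Lemma contact_form_xi : eta xi = 1.
Proof. exact: acm_eta_xi. Qed.

Lemma acm_A3 X : A (A (A X)) = - A X.
Proof.
by rewrite (acm_A2 S X) linearD linearN linearZ/= acm_A_xi scaler0 addr0.
Qed.

(** Computing A^3 from both sides gives eta(AX) xi = 0, and eta(xi) = 1. *)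
Lemma contact_form_A X : eta (A X) = 0.
Proof.
have := acm_A3 X; rewrite acm_A2 => /eqP.
rewrite -subr_eq0 opprK addrAC addNr add0r => /eqP /(congr1 eta).
rewrite (linear_formZ _ _ contact_form_linear) contact_form_xi mulr1.
by rewrite (linear_form0 contact_form_linear).
Qed.

Lemma linear_form_A2 L X : linear_form L ->
  L (A (A X)) = eta X * L xi - L X.
Proof. by move=> lL; rewrite acm_A2 addrC lL linear_formN. Qed.

Lemma metric_linear1 Y : linear_form (g^~ Y).
Proof. by move=> f X X'; rewrite metric_linear. Qed.

Lemma metric_linear2 X : linear_form (g X).
Proof. by move=> f Y Y'; rewrite !(Defs.metric_sym g X) metric_linear. Qed.

Lemma metricDl X X' Y : g (X + X') Y = g X Y + g X' Y.
Proof. exact: (linear_formD X X' (metric_linear1 Y)). Qed.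
Lemma metricDr X Y Y' : g X (Y + Y') = g X Y + g X Y'.
Proof. exact: (linear_formD Y Y' (metric_linear2 X)). Qed.
Lemma metricNl X Y : g (- X) Y = - g X Y.
Proof. exact: (linear_formN X (metric_linear1 Y)). Qed.
Lemma metricNr X Y : g X (- Y) = - g X Y.
Proof. exact: (linear_formN Y (metric_linear2 X)). Qed.
Lemma metricZl (f : K) X Y : g (f *: X) Y = f * g X Y.
Proof. exact: (linear_formZ f X (metric_linear1 Y)). Qed.
Lemma metricZr (f : K) X Y : g X (f *: Y) = f * g X Y.
Proof. exact: (linear_formZ f Y (metric_linear2 X)). Qed.
Definition metricE :=
  (metricDl, metricDr, metricNl, metricNr, metricZl, metricZr).

(** The difference of X and Y has length zero, hence vanishes at every point
    by definiteness. *)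
Lemma metric_inj X Y : (forall Z, g X Z = g Y Z) -> X = Y.
Proof.
move=> XY; apply/eqP; rewrite -subr_eq0; apply/eqP/val_inj/funext => f.
apply: smooth_ext => p; apply: (metric_eq0 (r := g)).
by rewrite metricDl metricNl XY subrr.
Qed.

Lemma metric_xi X : g X xi = eta X.
Proof. by rewrite /contact_form acm_eta_dual. Qed.

(** Compatibility applied to X and AY, where A^2 is minus the identity up to
    xi, and xi is orthogonal to the image of A. *)
Lemma metric_A_skew X Y : g (A X) Y = - g X (A Y).
Proof.
have := acm_compat S X (A Y); rewrite acm_A2.
rewrite -![acm_eta S _]/(eta _) contact_form_A mulr0 subr0.
rewrite !metricE metric_xi contact_form_A mulr0 addr0 => <-.
by rewrite opprK.
Qed.

Lemma fundamental_form_skew X Y : F X Y = - F Y X.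
Proof. by rewrite /fundamental_form metric_A_skew Defs.metric_sym. Qed.

Section Connection.
Context (D : connection M).

Lemma cov02_metric_sym X Y Z : cov02 D g X Y Z = cov02 D g X Z Y.
Proof.
rewrite /cov02 (Defs.metric_sym g Y Z) (Defs.metric_sym g Y).
by rewrite (Defs.metric_sym g _ Z) addrAC.
Qed.

Lemma cov02_fundamental_skew X Y Z : cov02 D F X Y Z = - cov02 D F X Z Y.
Proof.
rewrite /cov02 (fundamental_form_skew Y Z) vfN (fundamental_form_skew Y).
rewrite (fundamental_form_skew _ Z); pointwise_lra.
Qed.

Lemma cov02_generalized X Y Z :
  cov02 D G X Y Z = cov02 D g X Y Z + cov02 D F X Y Z.
Proof. rewrite /cov02 /generalized_metric vfD; pointwise_lra. Qed.

Lemma cov02_fundamental X Y Z :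
  cov02 D F X Y Z = cov02 D g X (A Y) Z + g (cov11 D A X Y) Z.
Proof.
rewrite /cov02 /cov11 /fundamental_form !metricE; pointwise_lra.
Qed.

(** Antisymmetrizing the covariant derivative computes the exterior derivative
    for every connection, provided the torsion corrects the bracket terms. *)
Lemma ext_d2_fundamental X Y Z : ext_d2 F X Y Z =
  cov02 D F X Y Z + cov02 D F Y Z X + cov02 D F Z X Y
  + F (torsion D X Y) Z + F (torsion D Y Z) X + F (torsion D Z X) Y.
Proof.
have tor X' Y' Z' : F (torsion D X' Y') Z' =
    F (D X' Y') Z' - F (D Y' X') Z' - F (lie_bracket X' Y') Z'.
  rewrite /fundamental_form !metric_A_skew /torsion !metricE; pointwise_lra.
rewrite /ext_d2 /cov02 !tor (fundamental_form_skew X (D _ _)).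
rewrite (fundamental_form_skew Y (D _ _)) (fundamental_form_skew Z (D _ _)).
clear tor; pointwise_lra.
Qed.

(** Covariant derivative of the identity A^2 = - id + eta (x) xi. *)
Lemma cov11_A X Y :
  cov11 D A X (A Y) + A (cov11 D A X Y) =
  ((X (eta Y) : K) - eta (D X Y)) *: xi + eta Y *: D X xi.
Proof.
rewrite /cov11 linearB/= addrA addrNK !acm_A2.
rewrite nabla_additiver nablaNr nabla_leibniz.
by rewrite scalerBl opprD opprK addrACA addNr add0r addrAC.
Qed.

End Connection.

(** * Three-forms satisfying the two structure equations *)

Section StructureEquations.
Context (T : V -> V -> V -> K) (formT : three_form T).

Lemma form_xi2 X Z : T X xi Z = - T xi X Z.
Proof. exact: form_swap12. Qed.

Lemma form_xi3 X Y : T X Y xi = T xi X Y.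
Proof. by rewrite -(form_rot formT). Qed.

Lemma form_xixi Z : T xi xi Z = 0.
Proof. have := form_swap12 formT xi xi Z; pointwise_lra. Qed.

Lemma form_xixi2 Y : T xi Y xi = 0.
Proof. by rewrite (form_swap23 formT) form_xixi oppr0. Qed.

Lemma form_A2_1 X Y Z : T (A (A X)) Y Z = eta X * T xi Y Z - T X Y Z.
Proof. exact: (linear_form_A2 X (form_linear formT Y Z)). Qed.

Lemma form_A2_2 X Y Z : T X (A (A Y)) Z = - (eta Y * T xi X Z) - T X Y Z.
Proof.
by rewrite (linear_form_A2 Y (form_linear2 formT X Z)) form_xi2 mulrN.
Qed.

Lemma form_A2_3 X Y Z : T X Y (A (A Z)) = eta Z * T xi X Y - T X Y Z.
Proof. by rewrite (linear_form_A2 Z (form_linear3 formT X Y)) form_xi3. Qed.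

Lemma form_Axi1 Y Z : T (A xi) Y Z = 0.
Proof. by rewrite acm_A_xi (linear_form0 (form_linear formT Y Z)). Qed.

Lemma form_Axi2 X Z : T X (A xi) Z = 0.
Proof. by rewrite acm_A_xi (linear_form0 (form_linear2 formT X Z)). Qed.

Lemma form_Axi3 X Y : T X Y (A xi) = 0.
Proof. by rewrite acm_A_xi (linear_form0 (form_linear3 formT X Y)). Qed.

(** These rules bring the arguments of T to a normal form: no square of A, no
    A xi, and xi only in first place. *)
Definition formE := (form_A2_1, form_A2_2, form_A2_3, form_Axi1, form_Axi2,
  form_Axi3, form_xixi, form_xixi2, form_xi2, form_xi3).

(* Psi and h stand for g((nabla_X A)Y, Z) and g(nabla_X xi, Y), nabla being
   the Levi-Civita connection.  Keeping them abstract isolates the identities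
   that link them to T. *)
Context (Psi : V -> V -> V -> K) (h : V -> V -> K).
Context (PsiA : forall X Y Z,
  Psi X (A Y) Z - Psi X Y (A Z) = eta Z * h X Y + eta Y * h X Z).
Context (h_xi : forall X, h X xi = 0).
Context (h_linear1 : forall Y, linear_form (h^~ Y)).
Context (h_linear2 : forall X, linear_form (h X)).

(** The common consequences of the two structure equations.  The first field
    says that xi is Killing, so that h = d eta / 2; in terms of d eta the third
    reads T(xi,X,Y) = d eta(AX,Y) / 3.  The last one says that A moves freely
    between the arguments of T when these are orthogonal to xi. *)
Record adapted : Prop := Adapted {
  adapted_skew : forall X Y, h X Y = - h Y X ;
  adapted_A : forall X Y, h (A X) Y = h X (A Y) ;
  adapted_xi : forall X Y, T xi X Y = (2 / 3) *: h (A X) Y ;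
  adapted_TA : forall X Y Z, T X (A Y) Z =
    T X Y (A Z) - (2 / 3) *: (eta Y * h X Z + eta Z * h X Y)
}.

(** What the Einstein metricity condition with skew torsion T says about the
    Levi-Civita derivative of A. *)
Definition einstein_eq : Prop := forall X Y Z, Psi X Y Z =
  - T X Y Z - T X (A Y) (A Z) + 2^-1 *: (T (A X) Y (A Z) + T (A X) (A Y) Z).

(** The almost-nearly cosymplectic condition, with dF = - 3 T and d eta the
    antisymmetrization of h. *)
Definition cosymplectic_eq : Prop := forall X Y Z, Psi X Y Z =
  T (A X) (A Y) Z + 6^-1 *: (eta Z * (h Y (A X) - h (A X) Y))
  - 2^-1 *: (eta Y * (h (A Z) X - h X (A Z))).

(** Substituting the equation into the derivative of A^2 = - id + eta (x) xi
    gives one relation [E] between T and h.  Its value at Y = xi expresses h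
    by T(xi,.,.), its value at X = xi shows that A is symmetric for
    T(xi,.,.), and what remains is the exchange rule for A. *)
Lemma einstein_eq_adapted : einstein_eq -> adapted.
Proof.
move=> ein.
have E X Y Z : 2 *: (T X Y (A Z) - T X (A Y) Z) =
    eta Y * (h X Z - T xi X (A Z) + 2^-1 *: T xi (A X) Z)
    + eta Z * (h X Y - T xi X (A Y) + 2^-1 *: T xi (A X) Y).
  have := PsiA X Y Z; rewrite !ein !formE; pointwise_lra.
have hE X Z : h X Z = - T xi X (A Z) - 2^-1 *: T xi (A X) Z.
  have := E X xi Z; rewrite contact_form_xi h_xi !formE; pointwise_lra.
have tA Y Z : T xi Y (A Z) = T xi (A Y) Z.
  have := E xi Y Z; rewrite !hE !formE; pointwise_lra.
have tAA X Z : T xi (A X) (A Z) = - T xi X Z.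
  by rewrite -tA !formE; pointwise_lra.
have hE' X Z : h X Z = - ((3 / 2) *: T xi (A X) Z).
  have := hE X Z; rewrite tA; pointwise_lra.
split=> [X Y|X Y|X Y|X Y Z]; rewrite ?hE'.
- rewrite (form_swap23 formT) tA; pointwise_lra.
- rewrite tAA !formE; pointwise_lra.
- rewrite !formE; pointwise_lra.
- have := E X Y Z; rewrite !hE' !tA; pointwise_lra.
Qed.

(** Here the information comes from the skew symmetry of Psi in its last two
    arguments, which the right-hand side of the equation does not show.  At
    (xi,xi) it gives h(xi,.) = 0, from which the derivative of
    A^2 = - id + eta (x) xi deduces that h is skew; at (Y,xi) it determines
    T(xi,.,.), and on general arguments it is the exchange rule for A, with AX
    in place of X. *)
Lemma cosymplectic_eq_adapted :
  (forall X Y Z, Psi X Y Z = - Psi X Z Y) -> cosymplectic_eq -> adapted.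
Proof.
move=> skewPsi cos.
have hA2 X Y : h (A (A X)) Y = eta X * h xi Y - h X Y.
  exact: (linear_form_A2 _ (h_linear1 Y)).
have hA2r X Y : h X (A (A Y)) = - h X Y.
  by rewrite (linear_form_A2 _ (h_linear2 X)) h_xi mulr0 add0r.
have hAxi Y : h (A xi) Y = 0.
  by rewrite acm_A_xi (linear_form0 (h_linear1 Y)).
have hAxir X : h X (A xi) = 0.
  by rewrite acm_A_xi (linear_form0 (h_linear2 X)).
have hxiA X : h xi (A X) = 0.
  have := skewPsi X xi xi.
  rewrite cos contact_form_xi !formE !hAxi !hAxir !h_xi; pointwise_lra.
have hxi X : h xi X = 0.
  have := hxiA (A X); rewrite hA2r; pointwise_lra.
have hS X Z : h X Z = - h Z X.
  have := PsiA X xi Z.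
  rewrite !cos contact_form_xi !contact_form_A !formE !hAxi !hAxir !h_xi.
  rewrite !hA2 !hA2r !hxi ?contact_form_xi; pointwise_lra.
have tAA X Y : T xi (A X) (A Y) = h (A Y) X + 3^-1 *: h (A X) Y.
  have := skewPsi X Y xi.
  rewrite !cos !formE !hAxi !hAxir !hxi !h_xi ?contact_form_xi.
  rewrite (hS Y (A X)) (hS X (A Y)); pointwise_lra.
have hA X Y : h (A X) Y = h X (A Y).
  have := form_swap23 formT xi (A X) (A Y); rewrite !tAA (hS X); pointwise_lra.
have tE X Y : T xi X Y = (2 / 3) *: h (A X) Y.
  have := tAA (A X) (A Y).
  rewrite !formE !hA2 !hxi (hS Y) hA; pointwise_lra.
split=> // X Y Z.
have TS X' : T (A X') (A Y) Z - T (A X') Y (A Z) =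
    - ((2 / 3) *: (eta Y * h X' (A Z) + eta Z * h X' (A Y))).
  have := skewPsi X' Y Z; rewrite !cos (form_swap23 formT _ (A Z)).
  rewrite (hS Y (A X')) (hS Z (A X')) (hS (A Y) X') (hS (A Z) X') !hA.
  pointwise_lra.
(* A^2 X is - X up to xi, where T is already known. *)
have := TS (A X); rewrite !formE !tE !hA !hA2r; pointwise_lra.
Qed.

Lemma adapted_equations_agree : adapted -> einstein_eq <-> cosymplectic_eq.
Proof.
case=> hS hA tE TA.
suff E X Y Z : - T X Y Z - T X (A Y) (A Z)
    + 2^-1 *: (T (A X) Y (A Z) + T (A X) (A Y) Z) =
  T (A X) (A Y) Z + 6^-1 *: (eta Z * (h Y (A X) - h (A X) Y))
  - 2^-1 *: (eta Y * (h (A Z) X - h X (A Z))).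
  by split=> eqn X Y Z; rewrite eqn E.
have := TA (A X) Y Z; have := TA X Y (A Z).
rewrite !formE !tE !contact_form_A (hS Y) (hS (A Z)) !hA; pointwise_lra.
Qed.

(** The combination of values of Psi is N(AX,AY,AZ) when N is computed with the
    Levi-Civita connection.  On arguments orthogonal to xi the structure
    equation and the exchange rule turn each of its four terms into - T; the
    terms in eta and h account for the components along xi. *)
Lemma adapted_nijenhuis : adapted -> cosymplectic_eq -> forall X Y Z,
  T X Y Z =
    - (4^-1 *: (Psi (A (A X)) (A Y) (A Z) - Psi (A (A Y)) (A X) (A Z)
                + Psi (A X) (A Y) (A (A Z)) - Psi (A Y) (A X) (A (A Z))))
    + 3^-1 *: (eta X * (h Y (A Z) - h (A Z) Y) + eta Y * (h Z (A X) - h (A X) Z)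
               + eta Z * (h X (A Y) - h (A Y) X)).
Proof.
case=> hS hA tE TA cos X Y Z; rewrite !cos !acm_A3 !contact_form_A.
rewrite (linear_formN _ (form_linear formT _ _)).
rewrite (linear_formN _ (form_linear formT _ _)).
have := TA Y X (A Z); have := TA X Y (A Z).
rewrite !formE (form_swap12 formT (A X) Y) (form_swap12 formT (A Y) X).
rewrite !tE !contact_form_A !hA.
rewrite (hS Z (A X)) (hS Z (A Y)) (hS Y (A X)) !hA.
rewrite !acm_A3 !(linear_formN _ (h_linear2 _)) (form_swap12 formT Y X Z).
rewrite !mul0r; pointwise_lra.
Qed.
End StructureEquations.
End AlmostContact.

(** * The Levi-Civita connection *)

Section LeviCivita.
Context (R : realType) (m : nat) (M : smoothManifold R m).
Context (S : almostContactMetric M) (Dg : connection M).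
Context (hDg : levi_civita (acm_g S) Dg).
Local Notation K := (smoothFun M).
Local Notation V := (vectorField M).
Local Notation g := (acm_g S).
Local Notation A := (acm_A S).
Local Notation xi := (acm_xi S).
Local Notation eta := (contact_form S).
Local Notation F := (fundamental_form S).
Local Notation G := (generalized_metric S).
Implicit Types X Y Z : V.

Definition cov_structure X Y Z : K := g (cov11 Dg A X Y) Z.

Definition cov_reeb X Y : K := g (Dg X xi) Y.

(** The only possible skew torsion, see [einstein_torsion]. *)
Definition form_torsion X Y Z : K := - (3^-1 *: ext_d2 F X Y Z).

Local Notation Psi := cov_structure.
Local Notation h := cov_reeb.
Local Notation T := form_torsion.

Lemma cov_metric0 X Y Z : X (g Y Z) = g (Dg X Y) Z + g (Dg X Z) Y :> K.
Proof.
have [/(_ X Y Z) + _] := hDg; rewrite /cov02 (Defs.metric_sym g Y (Dg X Z)).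
pointwise_lra.
Qed.

Lemma lie_bracket_levi_civita X Y : lie_bracket X Y = Dg X Y - Dg Y X.
Proof. by have [_ /(_ X Y)/eqP] := hDg; rewrite /torsion subr_eq0 => /eqP. Qed.

Lemma cov_fundamental X Y Z : cov02 Dg F X Y Z = Psi X Y Z.
Proof. by rewrite cov02_fundamental; have [-> _] := hDg; rewrite add0r. Qed.

Lemma cov_structure_skew X Y Z : Psi X Y Z = - Psi X Z Y.
Proof. by rewrite -!cov_fundamental cov02_fundamental_skew. Qed.

Lemma cov_reeb_xi X : h X xi = 0.
Proof.
have := cov_metric0 X xi xi; rewrite metric_xi contact_form_xi vf1 -/(h X xi).
pointwise_lra.
Qed.

Lemma cov_reebE X Y : h X Y = (X (eta Y) : K) - eta (Dg X Y).
Proof.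
have := cov_metric0 X Y xi; rewrite !metric_xi -/(h X Y); pointwise_lra.
Qed.

Lemma cov_structure_A X Y Z :
  Psi X (A Y) Z - Psi X Y (A Z) = eta Z * h X Y + eta Y * h X Z.
Proof.
have := congr1 (g^~ Z) (cov11_A S Dg X Y).
rewrite -cov_reebE !metricE (metric_A_skew S (cov11 _ _ _ _)).
rewrite (Defs.metric_sym g xi) metric_xi mulrC.
by rewrite /Psi /h {1}/cov11 !metricE.
Qed.

Lemma cov_reeb_linear1 Y : linear_form (h^~ Y).
Proof. by move=> f X X'; rewrite /h nabla_linearl metric_linear. Qed.

Lemma cov_reeb_linear2 X : linear_form (h X).
Proof. exact: metric_linear2. Qed.

Lemma ext_d1_contact X Y : ext_d1 eta X Y = h X Y - h Y X.
Proof.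
rewrite /ext_d1 !cov_reebE lie_bracket_levi_civita.
rewrite (linear_formD _ _ (contact_form_linear S)).
rewrite (linear_formN _ (contact_form_linear S)); pointwise_lra.
Qed.

Lemma ext_d2_levi_civita X Y Z :
  ext_d2 F X Y Z = Psi X Y Z + Psi Y Z X + Psi Z X Y.
Proof.
have [_ t0] := hDg; rewrite (ext_d2_fundamental S Dg) !t0 !cov_fundamental.
rewrite /F !linear0 !(linear_form0 (metric_linear1 S _)).
pointwise_lra.
Qed.

Lemma cov_structure_linear1 Y Z : linear_form (fun X => Psi X Y Z).
Proof.
move=> f X X'; rewrite /Psi /cov11 !nabla_linearl linearP !metricE.
pointwise_lra.
Qed.

(** Expressed through Psi, dF is visibly linear in its first argument: the
    bracket terms of the exterior derivative, which are not, have gone. *)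
Lemma form_torsion_three_form : three_form T.
Proof.
split=> [Y Z f X X'|X Y Z|X Y Z]; rewrite /T !ext_d2_levi_civita.
(* Psi is linear in its third argument because g is, and in its second by skew
   symmetry. *)
- rewrite cov_structure_linear1 [Psi _ _ (_ + _)]metric_linear2.
  rewrite ![Psi _ (_ + _) _]cov_structure_skew [Psi _ _ (_ + _)]metric_linear2.
  rewrite (cov_structure_skew Z X Y) (cov_structure_skew Z X' Y).
  rewrite /Psi; pointwise_lra.
- have := cov_structure_skew X Y Z; have := cov_structure_skew Y Z X.
  have := cov_structure_skew Z X Y; pointwise_lra.
- have := cov_structure_skew X Y Z; have := cov_structure_skew Y Z X.
  have := cov_structure_skew Z X Y; pointwise_lra.
Qed.

Lemma nijenhuis_levi_civita X Y Z : g (nijenhuis A X Y) Z =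
  Psi (A X) Y Z - Psi (A Y) X Z + Psi X Y (A Z) - Psi Y X (A Z).
Proof.
rewrite /nijenhuis !lie_bracket_levi_civita /Psi /cov11 !linearB/= !metricE.
rewrite !(metric_A_skew S _ Z) !(metric_A_skew S _ (A Z)).
pointwise_lra.
Qed.

Lemma almost_nearly_cosymplecticE :
  almost_nearly_cosymplectic S Dg <-> cosymplectic_eq S T Psi h.
Proof.
rewrite /almost_nearly_cosymplectic /=.
by split=> eqn X Y Z; have := eqn X Y Z; rewrite !ext_d1_contact.
Qed.

(** * Connections satisfying the Einstein metricity condition *)

Section EinsteinConnection.
Context (D : connection M).
Context (skewD : totally_skew_torsion g D).
Context (einsteinD : einstein_metricity G D).
Local Notation TD := (torsion3 g D).

(** Total skew symmetry moves the third argument, in which linearity is that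
    of the metric, to the place of any other one. *)
Lemma torsion3_three_form : three_form TD.
Proof.
have swap12 X Y Z : TD X Y Z = - TD Y X Z.
  by rewrite /torsion3 torsionC metricNl.
split=> // Y Z f X X'.
have rot X1 : TD X1 Y Z = g (torsion D Y Z) X1 by rewrite swap12 skewD opprK.
by rewrite !rot (metric_linear2 S).
Qed.

Lemma einstein_metricityE X Y Z :
  cov02 D g X Y Z + cov02 D F X Y Z = - TD X Y Z + TD X Y (A Z).
Proof.
rewrite -cov02_generalized einsteinD /generalized_metric /F metric_A_skew.
rewrite /torsion3; pointwise_lra.
Qed.

(** The part of the metricity condition symmetric in Y and Z. *)
Lemma einstein_cov_metric X Y Z :
  cov02 D g X Y Z = 2^-1 *: (TD X Y (A Z) + TD X Z (A Y)).
Proof.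
have := einstein_metricityE X Y Z; have := einstein_metricityE X Z Y.
rewrite (cov02_metric_sym S D X Z) (cov02_fundamental_skew S D X Z).
rewrite (skewD X Z Y); pointwise_lra.
Qed.

(** The part of the metricity condition skew in Y and Z. *)
Lemma einstein_cov_fundamental X Y Z :
  cov02 D F X Y Z = - TD X Y Z + 2^-1 *: (TD X Y (A Z) - TD X Z (A Y)).
Proof.
have := einstein_metricityE X Y Z; rewrite einstein_cov_metric; pointwise_lra.
Qed.

(** In the cyclic sum of D F plus torsion terms that gives dF, the terms with
    an argument AX, AY or AZ cancel and three copies of - TD remain. *)
Lemma einstein_torsion X Y Z : TD X Y Z = T X Y Z.
Proof.
have formT := torsion3_three_form; rewrite /T (ext_d2_fundamental S D).
rewrite !einstein_cov_fundamental /F !(metric_A_skew S (torsion _ _ _)).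
rewrite -/(TD X Y (A Z)) -/(TD Y Z (A X)) -/(TD Z X (A Y)).
rewrite (form_swap12 formT X Z (A Y)) (form_swap12 formT Y X (A Z)).
rewrite (form_swap12 formT Z Y (A X)) -(form_rot formT X Y Z).
rewrite -(form_rot formT Y Z X) -(form_rot formT X Y Z); pointwise_lra.
Qed.

(** Koszul's formula: B(X,Y,Z) = g(D_X Y - nabla_X Y, Z) is determined by
    B(X,Y,Z) - B(Y,X,Z) = TD(X,Y,Z) and B(X,Y,Z) + B(X,Z,Y) = - (D_X g)(Y,Z). *)
Lemma einstein_connectionE X Y Z : g (D X Y) Z = g (Dg X Y) Z
  + 2^-1 *: (T X Y Z - T X Z (A Y) - T Y Z (A X)).
Proof.
have formT := torsion3_three_form; rewrite -!einstein_torsion.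
(* In both facts the terms of D and nabla appear only through their
   difference. *)
have tor X' Y' Z' : TD X' Y' Z' = g (D X' Y') Z' - g (D Y' X') Z'
    - g (Dg X' Y') Z' + g (Dg Y' X') Z'.
  rewrite /torsion3 /torsion lie_bracket_levi_civita !metricE; pointwise_lra.
have met X' Y' Z' : g (D X' Y') Z' + g (D X' Z') Y' - g (Dg X' Y') Z'
    - g (Dg X' Z') Y' = - (2^-1 *: (TD X' Y' (A Z') + TD X' Z' (A Y'))).
  rewrite -einstein_cov_metric /cov02 cov_metric0.
  rewrite (Defs.metric_sym g Y'); pointwise_lra.
have := tor X Y Z; have := tor X Z Y; have := tor Y Z X.
have := met X Y Z; have := met Y X Z; have := met Z X Y.
rewrite (form_swap12 formT Z X (A Y)) (form_swap12 formT Z Y (A X)).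
rewrite (form_swap12 formT Y X (A Z)) (skewD X Z Y) -(form_rot formT X Y Z).
pointwise_lra.
Qed.

(** The two expressions of D F, from the metricity condition and from
    nabla F = Psi corrected by the difference of the connections, agree. *)
Lemma skew_einstein_eq : einstein_eq S T Psi.
Proof.
have formT := form_torsion_three_form.
move=> X Y Z.
have covDF : cov02 D F X Y Z = Psi X Y Z + (g (D X Y) (A Z) - g (Dg X Y) (A Z))
    - (g (D X Z) (A Y) - g (Dg X Z) (A Y)).
  rewrite -cov_fundamental /cov02 /F !(metric_A_skew S (D _ _)).
  rewrite !(metric_A_skew S (Dg _ _)) ![g (A Y) _](Defs.metric_sym g).
  pointwise_lra.
have := einstein_cov_fundamental X Y Z.
rewrite covDF !einstein_connectionE !einstein_torsion.
rewrite -(form_rot formT (A X) Y (A Z)) -(form_rot formT (A X) Z (A Y)).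
rewrite (form_swap23 formT X (A Z) (A Y)) (form_swap23 formT (A X) Z (A Y)).
rewrite ![_ + 2^-1 *: _ - _]addrAC !subrr !add0r.
clear covDF; pointwise_lra.
Qed.
End EinsteinConnection.

(** * Existence of the connection *)

Section Existence.
Context (adaptedT : adapted S T h).
Context (cosymplecticT : cosymplectic_eq S T Psi h).

(** The condition writes T(A^2 X, A^2 Y, Z) as Psi(AX,AY,Z) plus a multiple of
    eta(Z), and T(A^2 X, A^2 Y, .) differs from T(X,Y,.) by multiples of
    T(xi,X,.) and T(xi,Y,.), which are 2/3 of the products with nabla_{AX} xi
    and nabla_{AY} xi. *)
Lemma torsion_field_exists :
  exists t : V -> V -> V, forall X Y Z, g (t X Y) Z = T X Y Z.
Proof.
exists (fun X Y => cov11 Dg A (A X) (A Y) + (3^-1 *: h Y (A X)) *: xi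
  + (((2 / 3) *: eta X) *: Dg (A Y) xi
     - ((2 / 3) *: eta Y) *: Dg (A X) xi)) => X Y Z.
have formT := form_torsion_three_form.
have [hS hA tE _] := adaptedT.
have hA3 X' Y' : h X' (A (A (A Y'))) = - h X' (A Y').
  by rewrite acm_A3 (linear_formN _ (cov_reeb_linear2 X')).
have := cosymplecticT (A X) (A Y) Z.
rewrite {1}/cov_structure; move: (cov11 _ _ _ _) => c gc.
rewrite !metricE (Defs.metric_sym g xi) metric_xi gc.
rewrite -/(h (A X) Z) -/(h (A Y) Z).
rewrite !(formE S formT) !tE !contact_form_A !hA !hA3 (hS Y (A X)) !hA.
clear gc; pointwise_lra.
Qed.

(** The products are the Koszul terms of [einstein_connectionE], in which the
    exchange rule for A has replaced the terms with AX or AY by terms in h. *)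
Lemma deformation_exists : exists B : V -> V -> V, forall X Y Z,
  g (B X Y) Z = 2^-1 *: T X Y Z - 3^-1 *: (eta X * h Y Z + eta Y * h X Z).
Proof.
have [t gt] := torsion_field_exists.
exists (fun X Y => (2^-1 *: (1 : K)) *: t X Y
  - ((3^-1 *: eta X) *: Dg Y xi + (3^-1 *: eta Y) *: Dg X xi)) => X Y Z.
rewrite !metricE gt -/(h X Z) -/(h Y Z); pointwise_lra.
Qed.

(** The skew part of B is T, so that the new connection has torsion T; the
    metricity condition then reduces to [einstein_eq], which is equivalent to
    the hypothesis by [adapted_equations_agree]. *)
Lemma skew_einstein_exists : exists D : connection M,
  totally_skew_torsion g D /\ einstein_metricity G D.
Proof.
have formT := form_torsion_three_form.
have [B gB] := deformation_exists.
have [f X X' Y|f X Y Y'|D DE] := @connection_deform R m M Dg B.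
- apply: (metric_inj (S := S)) => Z; rewrite !metricE !gB.
  rewrite (form_linear formT) (contact_form_linear S) (cov_reeb_linear1 Z).
  pointwise_lra.
- apply: (metric_inj (S := S)) => Z; rewrite !metricE !gB.
  rewrite (form_linear2 formT) (contact_form_linear S) (cov_reeb_linear1 Z).
  pointwise_lra.
have torD X Y Z : torsion3 g D X Y Z = T X Y Z.
  rewrite /torsion3 /torsion !DE lie_bracket_levi_civita !metricE !gB.
  rewrite (form_swap12 formT Y); pointwise_lra.
exists D; split=> [X Y Z|X Y Z]; first by rewrite !torD (form_swap23 formT).
rewrite /generalized_metric /F metric_A_skew -/(torsion3 g D X Y Z).
rewrite -/(torsion3 g D X Y (A Z)) !torD.
have -> : cov02 D G X Y Z = Psi X Y Z - g (B X Y) Z + g (B X Y) (A Z)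
    - g (B X Z) Y - g (B X Z) (A Y).
  rewrite cov02_generalized -cov_fundamental.
  rewrite /cov02 !DE cov_metric0 /F !linearD /= !metricE.
  rewrite ![g (A (B _ _)) _]metric_A_skew.
  rewrite ![g Y _](Defs.metric_sym g) ![g (A Y) (B _ _)](Defs.metric_sym g).
  pointwise_lra.
rewrite !gB.
have [hS hA tE TA] := adaptedT.
have [_ /(_ cosymplecticT X Y Z) ->] :=
  adapted_equations_agree formT Psi adaptedT.
have := TA X Y Z; have := TA X Y (A Z).
have := TA (A X) Y Z; have := TA Y X (A Z).
rewrite (form_swap12 formT Y (A X)) (form_swap12 formT Y X).
rewrite (form_swap23 formT X Z Y) (form_swap23 formT X Z (A Y)).
rewrite !(formE S formT) !contact_form_A !tE !hA.
rewrite (hS Z Y) (hS Z (A Y)) !hA; pointwise_lra.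
Qed.
End Existence.

(** * Consequences for the connection and its torsion *)

Local Notation dF := (ext_d2 F).
Local Notation deta := (ext_d1 eta).

Lemma skew_einstein_existsP :
  (exists D : connection M, totally_skew_torsion g D /\ einstein_metricity G D)
  <-> almost_nearly_cosymplectic S Dg.
Proof.
have formT := form_torsion_three_form.
have PsiA := cov_structure_A; have h_xi := cov_reeb_xi.
rewrite almost_nearly_cosymplecticE; split=> [[D [skewD einD]]|cos].
  have ein := skew_einstein_eq skewD einD.
  have ad := einstein_eq_adapted formT PsiA h_xi ein.
  by apply/(adapted_equations_agree formT Psi ad).
apply: skew_einstein_exists (cos).
exact: (cosymplectic_eq_adapted formT PsiA h_xi cov_reeb_linear1
  cov_reeb_linear2 cov_structure_skew cos).
Qed.

Section Einstein.
Context (D : connection M).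
Context (skewD : totally_skew_torsion g D).
Context (einsteinD : einstein_metricity G D).

Let formT : three_form T := form_torsion_three_form.

Lemma skew_einstein_adapted : adapted S T h.
Proof.
apply: (einstein_eq_adapted formT cov_structure_A cov_reeb_xi).
exact: (skew_einstein_eq skewD einsteinD).
Qed.

Let detaE X Y : deta X Y = 2 *: h X Y.
Proof.
by rewrite ext_d1_contact (adapted_skew skew_einstein_adapted Y); pointwise_lra.
Qed.

Lemma form_torsion_nijenhuis X Y Z : T X Y Z =
  - (4^-1 *: g (nijenhuis A (A X) (A Y)) (A Z))
  + 3^-1 *: (eta X * deta Y (A Z) + eta Y * deta Z (A X)
             + eta Z * deta X (A Y)).
Proof.
have ad := skew_einstein_adapted.
have cos : cosymplectic_eq S T Psi h.
  apply/(adapted_equations_agree formT Psi ad).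
  exact: (skew_einstein_eq skewD einsteinD).
rewrite (adapted_nijenhuis formT cov_reeb_linear2 ad cos).
by rewrite nijenhuis_levi_civita !ext_d1_contact.
Qed.

(** The exchange rule for A in terms of d eta = 2 h. *)
Lemma form_torsion_A X Y Z : T X Y (A Z) - T X (A Y) Z =
  3^-1 *: (eta Y * deta X Z + eta Z * deta X Y).
Proof.
rewrite (adapted_TA skew_einstein_adapted) !detaE; pointwise_lra.
Qed.

Lemma skew_einstein_nabla X Y Z : g (D X Y) Z = g (Dg X Y) Z
  - 6^-1 *: dF X Y Z - 6^-1 *: (eta X * deta Y Z + eta Y * deta X Z).
Proof.
rewrite (einstein_connectionE skewD einsteinD).
have := form_torsion_A X Y Z; have := form_torsion_A Y X Z.
rewrite (form_swap23 formT X Z) (form_swap23 formT Y Z) (form_swap12 formT Y X).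
rewrite [deta Y X]detaE (adapted_skew skew_einstein_adapted Y) [deta X Y]detaE.
rewrite [T X Y Z]/form_torsion; pointwise_lra.
Qed.

Lemma skew_einstein_cov_metric X Y Z : cov02 D g X Y Z =
  - (6^-1 *: (eta Y * deta Z X + eta Z * deta Y X)).
Proof.
rewrite (einstein_cov_metric skewD einsteinD).
rewrite !(einstein_torsion skewD einsteinD) (form_swap23 formT X Z).
have := form_torsion_A X Y Z.
rewrite !detaE (adapted_skew skew_einstein_adapted Z).
rewrite (adapted_skew skew_einstein_adapted Y); pointwise_lra.
Qed.

Lemma skew_einstein_cov_generalized X Y Z :
  cov02 D G X Y Z = 3^-1 *: (dF X Y Z - dF X Y (A Z)).
Proof.
rewrite cov02_generalized (einstein_metricityE einsteinD).
by rewrite !(einstein_torsion skewD einsteinD) /form_torsion; pointwise_lra.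
Qed.

Lemma skew_einstein_cov_fundamental X Y Z :
  cov02 D F X Y Z = 3^-1 *: (dF X Y Z - dF X Y (A Z))
    + 6^-1 *: (eta Y * deta Z X + eta Z * deta Y X).
Proof.
have := skew_einstein_cov_generalized X Y Z.
rewrite cov02_generalized skew_einstein_cov_metric; pointwise_lra.
Qed.
End Einstein.
End LeviCivita.

Unset Implicit Arguments.

(* In the formulas for D, cov02 D g and cov02 D F the sign of the terms
   eta * deta is the one forced by the hypotheses together with the formula
   for T; note that these give deta (A X) (A Y) = - deta X Y. *)
Theorem theorem3p7 (R : realType) (n : nat) (M : smoothManifold R (2 * n).+1)
    (S : almostContactMetric M) (Dg : connection M)
    (hDg : levi_civita (acm_g S) Dg) :
  let g := acm_g S in
  let A := acm_A S in
  let F := fundamental_form S in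
  let G := generalized_metric S in
  let dF := ext_d2 F in
  let eta := contact_form S in
  let deta := ext_d1 eta in
  let T := torsion3 g in
  let N := fun X Y Z : vectorField M => g (nijenhuis A X Y) Z in
  let skew_einstein (D : connection M) :=
    totally_skew_torsion g D /\ einstein_metricity G D in
  [/\ (exists D : connection M, skew_einstein D)
        <-> almost_nearly_cosymplectic S Dg,
      forall D : connection M, skew_einstein D ->
        [/\ forall X Y Z : vectorField M,
              T D X Y Z = - (3^-1 *: dF X Y Z) /\
              - (3^-1 *: dF X Y Z) =
                - (4^-1 *: N (A X) (A Y) (A Z))
                + 3^-1 *: (eta X * deta Y (A Z) + eta Y * deta Z (A X)
                           + eta Z * deta X (A Y)),
            forall X Y Z : vectorField M,
              g (D X Y) Z = g (Dg X Y) Z - 6^-1 *: dF X Y Z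
                - 6^-1 *: (eta X * deta Y Z + eta Y * deta X Z),
            forall X Y Z : vectorField M,
              cov02 D G X Y Z = 3^-1 *: (dF X Y Z - dF X Y (A Z)),
            forall X Y Z : vectorField M,
              cov02 D g X Y Z =
                - (6^-1 *: (eta Y * deta Z X + eta Z * deta Y X))
          & forall X Y Z : vectorField M,
              cov02 D F X Y Z = 3^-1 *: (dF X Y Z - dF X Y (A Z))
                + 6^-1 *: (eta Y * deta Z X + eta Z * deta Y X)]
    & forall D D' : connection M, skew_einstein D -> skew_einstein D' ->
        forall X Y : vectorField M, D X Y = D' X Y].
Proof.
move=> g A F G dF eta deta T N skew_einstein.
split=> [|D [skewD einD]|D D' [skewD einD] [skewD' einD'] X Y].
- exact: skew_einstein_existsP.
- split=> X Y Z.
  + split; first exact: einstein_torsion.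
    exact: (form_torsion_nijenhuis hDg skewD einD).
  + exact: skew_einstein_nabla.
  + exact: skew_einstein_cov_generalized.
  + exact: (skew_einstein_cov_metric hDg skewD einD).
  + exact: (skew_einstein_cov_fundamental hDg skewD einD).
(* [skew_einstein_nabla] expresses the products of D X Y without D. *)
- apply: (metric_inj (S := S)) => Z.
  rewrite (skew_einstein_nabla hDg skewD einD).
  by rewrite (skew_einstein_nabla hDg skewD' einD').
Qed.
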